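(* Let $\{(x^k,\lambda^k,s^k)\}$ be generated by the arc-search interior-point algorithm with Nesterov's restarting strategy (described in the context, with inputs $\theta\in(0,1/(2+\sqrt2))$, $\beta\in(0,1)$, $\epsilon\in(0,1)$), started from an initial point $(x^0,\lambda^0,s^0)\in\mathcal N(\theta)$ such that, for a sufficiently large parameter $\rho\ge 1$, $x^*\le\rho x^0$ and $s^*\le\rho s^0$ hold for some $(x^*,\lambda^*,s^* )\in\mathcal S$. Let $L=\ln(\mu_0/\epsilon)$. Then the algorithm terminates with an iterate $(x^k,\lambda^k,s^k)$ satisfying $$\mu_k\le\epsilon,\qquad \|r_b(x^k)\|\le\frac{\|r_b(x^0)\|}{\mu_0}\,\epsilon,\qquad \|r_c(\lambda^k,s^k)\|\le\frac{\|r_c(\lambda^0,s^0)\|}{\mu_0}\,\epsilon$$ in at most $\mathcal O(nL)$ iterations.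
   Context: Problem: $A\in\mathbb R^{m\times n}$, $b\in\mathbb R^m$, $c\in\mathbb R^n$; primal $\min c^\top x$ subject to $Ax=b$, $x\ge0$; dual $\max b^\top\lambda$ subject to $A^\top\lambda+s=c$, $s\ge0$. Standing assumptions: both problems have interior feasible points, i.e. there exist $x>0$ with $Ax=b$ and $(\lambda,s)$ with $s>0$, $A^\top\lambda+s=c$; the rows of $A$ are linearly independent. $\mathcal S$ is the set of primal-dual optimal solutions $(x^*,\lambda^*,s^* )$, i.e. $Ax^*=b$, $A^\top\lambda^*+s^*=c$, $(x^*,s^* )\ge0$, $x^*_is^*_i=0$ for all $i$. Notation: $\circ$ is the componentwise product, $e$ the all-ones vector, $\|\cdot\|$ the Euclidean norm, $\|\cdot\|_\infty$ the infinity norm, inequalities between vectors are componentwise; a capital letter denotes the diagonal matrix of the vector ($X^k=X_k=\mathrm{diag}(x^k)$, $S^k=\mathrm{diag}(s^k)$, $Z^k=\mathrm{diag}(z^k)$, etc.). $r_b(x)=Ax-b$, $r_c(\lambda,s)=A^\top\lambda+s-c$, $\mu_k=(x^k)^\top s^k/n$, $\mu_k^z=(z^k)^\top s^k/n$. $\mathcal N(\theta)=\{(x,\lambda,s): (x,s)>0,\ \|x\circ s-\mu e\|\le\theta\mu\}$ with $\mu=x^\top s/n$. Algorithm. Inputs: $\theta\in(0,1/(2+\sqrt2))$, $(x^0,\lambda^0,s^0)\in\mathcal N(\theta)$, $\beta\in(0,1)$, $\epsilon\in(0,1)$. For $k=0,1,2,\dots$, given the strictly positive iterate $(x^k,\lambda^k,s^k)$,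 $(x^k,s^k)>0$: 1. Stop and output $(x^k,\lambda^k,s^k)$ if the three inequalities displayed in the claim hold for it. 2. For $k>0$ let $\delta(x^k)=x^k-x^{k-1}$ and $$\beta_k=\min\Big\{\frac{\beta}{\|X_k^{-1}\delta(x^k)\|_\infty},\ \min_{j:\ r_b(x^k)_j\ne r_b(x^{k-1})_j}\Big|\frac{r_b(x^k)_j}{r_b(x^k)_j-r_b(x^{k-1})_j}\Big|\Big\}$$ (a minimum over the empty set is $+\infty$; if $\delta(x^k)=0$ then $z^k=x^k$ below). 3. $z^k=x^k+\beta_k\delta(x^k)$ if $k>0$ and $(x^k+\beta_k\delta(x^k),\lambda^k,s^k)\in\mathcal N(\theta)$; otherwise $z^k=x^k$. 4. $(\dot z,\dot\lambda,\dot s)$ solves $A\dot z=r_b(z^k)$, $A^\top\dot\lambda+\dot s=r_c(\lambda^k,s^k)$, $S^k\dot z+Z^k\dot s=z^k\circ s^k$; and $(\ddot z,\ddot\lambda,\ddot s)$ solves $A\ddot z=0$, $A^\top\ddot\lambda+\ddot s=0$, $S^k\ddot z+Z^k\ddot s=-2\dot z\circ\dot s$. 5. With $x(\alpha)=z^k-\dot z\sin\alpha+\ddot z(1-\cos\alpha)$, $\lambda(\alpha)=\lambda^k-\dot\lambda\sin\alpha+\ddot\lambda(1-\cos\alpha)$, $s(\alpha)=s^k-\dot s\sin\alpha+\ddot s(1-\cos\alpha)$, let $\alpha_k\in(0,\pi/2]$ be the largest number such that for all $\alpha\in(0,\alpha_k]$: $x(\alpha)>0$, $s(\alpha)>0$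 and $\|x(\alpha)\circ s(\alpha)-(1-\sin\alpha)\mu_k^z e\|\le2\theta(1-\sin\alpha)\mu_k^z$. 6. $(\Delta x,\Delta\lambda,\Delta s)$ solves $A\Delta x=0$, $A^\top\Delta\lambda+\Delta s=0$, $S(\alpha_k)\Delta x+X(\alpha_k)\Delta s=(1-\sin\alpha_k)\mu_ke-x(\alpha_k)\circ s(\alpha_k)$, where $X(\alpha_k)=\mathrm{diag}(x(\alpha_k))$, $S(\alpha_k)=\mathrm{diag}(s(\alpha_k))$. 7. $(x^{k+1},\lambda^{k+1},s^{k+1})=(x(\alpha_k),\lambda(\alpha_k),s(\alpha_k))+(\Delta x,\Delta\lambda,\Delta s)$. *)

(* Defs.v *)
From HB Require Import structures.
From mathcomp Require Import all_boot all_order all_algebra.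
From mathcomp Require Import all_classical all_reals all_analysis.

Set Implicit Arguments.
Unset Strict Implicit.
Unset Printing Implicit Defensive.

Import Order.TTheory GRing.Theory Num.Theory.
Import numFieldNormedType.Exports.

Local Open Scope ring_scope.

Section Vectors.
Context {R : realType} {p : nat}.
Implicit Types u v : 'cV[R]_p.

Definition vpos v : bool := [forall i, 0 < v i 0].
Definition vle u v : bool := [forall i, u i 0 <= v i 0].
Definition cprod u v : 'cV[R]_p := \col_i (u i 0 * v i 0).
Definition ones : 'cV[R]_p := const_mx 1.
Definition diag v : 'M[R]_p := diag_mx v^T.

(* The library norm `|v| on matrices is the maximum norm, so the Euclidean norm
   is introduced separately. *)
Definition norm2 v : R := Num.sqrt (\sum_i v i 0 ^+ 2).

End Vectors.

Record iterate (R : realType) (m n : nat) := Iterate {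
  xpart : 'cV[R]_n;
  lpart : 'cV[R]_m;
  spart : 'cV[R]_n }.

Section ArcSearch.
Context {R : realType} {m n : nat}.
Variables (A : 'M[R]_(m, n)) (b : 'cV[R]_m) (c : 'cV[R]_n).
Implicit Types (x s z : 'cV[R]_n) (l : 'cV[R]_m) (w : iterate R m n).

Definition r_b x : 'cV[R]_m := A *m x - b.
Definition r_c l s : 'cV[R]_n := A^T *m l + s - c.
Definition duality_measure x s : R := (x^T *m s) 0 0 / n%:R.
Definition mu w : R := duality_measure (xpart w) (spart w).

Definition interior_feasible : Prop :=
  (exists x, vpos x /\ A *m x = b) /\
  (exists l s, vpos s /\ A^T *m l + s = c).

Definition primal_dual_optimal w : Prop :=
  [/\ A *m xpart w = b, A^T *m lpart w + spart w = c,
      vle 0 (xpart w), vle 0 (spart w)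
    & forall i, xpart w i 0 * spart w i 0 = 0].

Definition neighborhood (theta : R) w : bool :=
  [&& vpos (xpart w), vpos (spart w) &
      norm2 (cprod (xpart w) (spart w) - mu w *: ones) <= theta * mu w].

Definition stopping_criterion (eps : R) w0 w : Prop :=
  [/\ mu w <= eps,
      norm2 (r_b (xpart w)) <= norm2 (r_b (xpart w0)) / mu w0 * eps
    & norm2 (r_c (lpart w) (spart w)) <=
      norm2 (r_c (lpart w0) (spart w0)) / mu w0 * eps].

(* The fold starts from the first term of the outer minimum, so an empty range
   of j contributes +oo. If x = xprev, the first term is the junk value
   beta / 0 = 0; this is harmless because the result only multiplies
   x - xprev. *)
Definition restart_weight (beta : R) (xprev x : 'cV[R]_n) : R :=
  \big[Num.min/beta / `|invmx (diag x) *m (x - xprev)|]_(j < m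
        | r_b x j 0 != r_b xprev j 0)
     `|r_b x j 0 / (r_b x j 0 - r_b xprev j 0)|.

Definition restart_point (theta beta : R) (seqw : nat -> iterate R m n)
    (k : nat) : 'cV[R]_n :=
  let x := xpart (seqw k) in
  if k is k'.+1 then
    let xprev := xpart (seqw k') in
    let y := x + restart_weight beta xprev x *: (x - xprev) in
    if neighborhood theta (Iterate y (lpart (seqw k)) (spart (seqw k)))
    then y else x
  else x.

(* d1, d2 play the roles of the first and second derivatives of the arc. *)
Definition first_derivative z w (d1 : iterate R m n) : Prop :=
  [/\ A *m xpart d1 = r_b z,
      A^T *m lpart d1 + spart d1 = r_c (lpart w) (spart w)
    & diag (spart w) *m xpart d1 + diag z *m spart d1 = cprod z (spart w)].

Definition second_derivative z w (d1 d2 : iterate R m n) : Prop :=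
  [/\ A *m xpart d2 = 0,
      A^T *m lpart d2 + spart d2 = 0
    & diag (spart w) *m xpart d2 + diag z *m spart d2 =
      - 2 *: cprod (xpart d1) (spart d1)].

Definition arc z w (d1 d2 : iterate R m n) (alpha : R) : iterate R m n :=
  Iterate (z - sin alpha *: xpart d1 + (1 - cos alpha) *: xpart d2)
          (lpart w - sin alpha *: lpart d1 + (1 - cos alpha) *: lpart d2)
          (spart w - sin alpha *: spart d1 + (1 - cos alpha) *: spart d2).

Definition arc_admissible (theta muz : R) (arcw : R -> iterate R m n)
    (alpha : R) : Prop :=
  [/\ vpos (xpart (arcw alpha)), vpos (spart (arcw alpha))
    & norm2 (cprod (xpart (arcw alpha)) (spart (arcw alpha))
             - ((1 - sin alpha) * muz) *: ones)
      <= 2 * theta * (1 - sin alpha) * muz].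

Definition step_range (theta muz : R) (arcw : R -> iterate R m n)
    (alpha : R) : Prop :=
  0 < alpha <= pi / 2 /\
  forall t, 0 < t <= alpha -> arc_admissible theta muz arcw t.

Definition largest_step (theta muz : R) (arcw : R -> iterate R m n)
    (alpha : R) : Prop :=
  step_range theta muz arcw alpha /\
  forall alpha', step_range theta muz arcw alpha' -> alpha' <= alpha.

Definition corrector (muk alpha : R) (wa d : iterate R m n) : Prop :=
  [/\ A *m xpart d = 0,
      A^T *m lpart d + spart d = 0
    & diag (spart wa) *m xpart d + diag (xpart wa) *m spart d =
      ((1 - sin alpha) * muk) *: ones - cprod (xpart wa) (spart wa)].

Definition iteration (theta beta : R) (seqw : nat -> iterate R m n)
    (k : nat) : Prop :=
  let w := seqw k in
  let z := restart_point theta beta seqw k in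
  vpos (xpart w) /\ vpos (spart w) /\
  exists (d1 d2 d : iterate R m n) (alpha : R),
    let wa := arc z w d1 d2 alpha in
    [/\ first_derivative z w d1,
        second_derivative z w d1 d2,
        largest_step theta (duality_measure z (spart w)) (arc z w d1 d2) alpha,
        corrector (mu w) alpha wa d
      & seqw k.+1 = Iterate (xpart wa + xpart d) (lpart wa + lpart d)
                            (spart wa + spart d)].

(* Terms of seqw after the first one that meets the stopping criterion are
   unconstrained. *)
Definition generated (theta beta eps : R) (seqw : nat -> iterate R m n) :
    Prop :=
  forall k, (forall j, (j <= k)%N ->
               ~ stopping_criterion eps (seqw 0%N) (seqw j)) ->
    iteration theta beta seqw k.

Definition terminates_at (eps : R) (seqw : nat -> iterate R m n)
    (k : nat) : Prop :=
  stopping_criterion eps (seqw 0%N) (seqw k) /\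
  forall j, (j < k)%N -> ~ stopping_criterion eps (seqw 0%N) (seqw j).

End ArcSearch.

(* Main.v *)
(* At a point (z, s) of N(theta), write the derivatives of the arc relative to
   z and s.  Since the residuals of (z, s) are multiples
   eta <= nu = mu_k / mu_0 of the initial ones, comparison with the optimal
   solution bounds the relative first derivatives by O(n) in Euclidean norm, so
   the relative second derivatives are O(n^2), and the deviation of x(a) s(a)
   from (1 - sin a) z s is O((n sin a)^3) mu: the step satisfies
   sin alpha >= const / n.

   After a restart the corrector aims at mu_k while the arc stays close to
   mu_k^z, so the next iterate may leave N(theta).  But if an iterate is outside
   N(theta) and no restart takes place, then mu_k^z = mu_k and the corrector
   brings the next iterate back into N(theta), whatever the step length.  Hence
   of any two consecutive iterations at least one makes a step of order 1 / n,
   while mu and both residuals never increase. *)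

Require Import Defs.
From HB Require Import structures.
From mathcomp Require Import all_boot all_order all_algebra.
From mathcomp Require Import all_classical all_reals all_analysis.
From mathcomp Require Import ring lra.

Set Implicit Arguments.
Unset Strict Implicit.
Unset Printing Implicit Defensive.

Import Order.TTheory GRing.Theory Num.Theory.
Import numFieldNormedType.Exports.

Local Open Scope ring_scope.

(** * Euclidean norms and inequalities for finite sums *)

Lemma norm2_le (R : realType) (p : nat) (v : 'cV[R]_p) (t : R) :
  0 <= t -> (norm2 v <= t) = (\sum_i v i 0 ^+ 2 <= t ^+ 2).
Proof.
move=> t0; rewrite /norm2 -[in LHS](ger0_norm t0) -sqrtr_sqr ler_sqrt //.
exact: sqr_ge0.
Qed.

Lemma le_of_sqr (R : realType) (u t : R) : 0 <= t -> u ^+ 2 <= t ^+ 2 -> u <= t.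
Proof.
move=> t0 h; apply: le_trans (ler_norm u) _.
by rewrite -(@ler_sqr _ `|u| t) ?nnegrE // real_normK ?num_real.
Qed.

Lemma norm2Z (R : realType) (p : nat) (a : R) (v : 'cV[R]_p) :
  0 <= a -> norm2 (a *: v) = a * norm2 v.
Proof.
move=> a0; rewrite /norm2 -[X in X * _](ger0_norm a0) -sqrtr_sqr -sqrtrM ?sqr_ge0 //.
by rewrite mulr_sumr; congr Num.sqrt; apply: eq_bigr => i _; rewrite mxE exprMn.
Qed.

Lemma sum_sqr_le_sqr_sum (R : realType) (n : nat) (f : 'I_n -> R) :
  (forall i, 0 <= f i) -> \sum_i f i ^+ 2 <= (\sum_i f i) ^+ 2.
Proof.
move=> f0; rewrite [leRHS]expr2 mulr_suml; apply: ler_sum => i _.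
rewrite expr2 ler_wpM2l // (bigD1 i) //= lerDl sumr_ge0 //.
Qed.

(** Only the positive parts are bounded by [t], but a zero sum gives the negative parts the same
    total; each family then contributes one square of that total. *)
Lemma sum_sqr_of_sum0 (R : realType) (n : nat) (f t : 'I_n -> R) :
  (forall i, f i <= t i) -> (forall i, 0 <= t i) -> \sum_i f i = 0 ->
  \sum_i f i ^+ 2 <= 2 * (\sum_i t i) ^+ 2.
Proof.
move=> ft t0 f0; pose fp i := Num.max 0 (f i); pose fn i := Num.max 0 (- f i).
have fp0 i : 0 <= fp i by rewrite le_max lexx.
have fn0 i : 0 <= fn i by rewrite le_max lexx.
have fE i : f i = fp i - fn i by rewrite /fp /fn /Num.max; do 2 case: ifP; lra.
have f2 i : f i ^+ 2 = fp i ^+ 2 + fn i ^+ 2.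
  by rewrite /fp /fn /Num.max; do 2 case: ifP; lra || nra.
have pn : \sum_i fp i = \sum_i fn i.
  apply/eqP; rewrite -subr_eq0 -sumrB; apply/eqP.
  by rewrite -[RHS]f0; apply: eq_bigr => i _; rewrite fE.
have pt : (\sum_i fp i) ^+ 2 <= (\sum_i t i) ^+ 2.
  rewrite ler_sqr ?nnegrE ?sumr_ge0 //; apply: ler_sum => i _.
  by rewrite ge_max t0 ft.
rewrite (eq_bigr _ (fun i _ => f2 i)) big_split /=.
have := sum_sqr_le_sqr_sum fp0; have := sum_sqr_le_sqr_sum fn0; rewrite -pn; lra.
Qed.

(* The sharp constant 8 matters: in [corrector_recenters] the condition
   [theta < 1 / (2 + sqrt 2)] leaves no slack. *)
Lemma sum_sqr_prod_orthogonal (R : realType) (n : nat) (x s d e : 'I_n -> R) :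
  (forall i, 0 < x i) -> (forall i, 0 < s i) -> \sum_i d i * e i = 0 ->
  8 * (\sum_i (d i * e i) ^+ 2) <=
    (\sum_i (s i * d i + x i * e i) ^+ 2 / (x i * s i)) ^+ 2.
Proof.
move=> x0 s0 de0.
pose t i := (s i * d i + x i * e i) ^+ 2 / (x i * s i) / 4.
have t0 i : 0 <= t i.
  by rewrite /t !divr_ge0 ?sqr_ge0 // mulr_ge0 // ltW.
have det i : d i * e i <= t i.
  rewrite /t -mulrA -invfM ler_pdivlMr ?mulr_gt0 //.
  rewrite -subr_ge0 (_ : _ - _ = (s i * d i - x i * e i) ^+ 2) ?sqr_ge0 //; ring.
have := sum_sqr_of_sum0 det t0 de0; rewrite /t -mulr_suml => h.
set S := \sum_i _ / _ in h *; lra.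
Qed.

(** * The arc in relative coordinates *)

(** The weight [t] balances factors of different size: [arc_estimate] takes [t] equal to [N] to pair
    a first derivative of order [N] with a second one of order [N ^+ 2]. *)
Lemma young_norm (R : realType) (u v t : R) :
  0 < t -> `|u * v| <= (t * u ^+ 2 + v ^+ 2 / t) / 2.
Proof.
move=> t0; have d0 w : 0 <= w ^+ 2 / (2 * t) by rewrite divr_ge0 ?sqr_ge0 // mulr_ge0 // ltW.
rewrite ler_norml; apply/andP; split; rewrite -subr_ge0.
  by rewrite (_ : _ - _ = (t * u + v) ^+ 2 / (2 * t)) //; field; rewrite gt_eqF.
by rewrite (_ : _ - _ = (t * u - v) ^+ 2 / (2 * t)) //; field; rewrite gt_eqF.
Qed.

(* [a], [b] and [a'], [b'] are the first and second derivatives of the arc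
   relative to [x] and [s], [g = x s], [sg = sin alpha], [kp = 1 - cos alpha]. *)
Lemma arc_estimate (R : realType) (n : nat) (g a b a' b' : 'I_n -> R)
    (mu theta N sg kp : R) :
  0 < mu -> 0 < theta < 2^-1 ->
  (forall i, (1 - theta) * mu <= g i) -> \sum_i (g i - mu) ^+ 2 <= (theta * mu) ^+ 2 ->
  (forall i, a i + b i = 1) ->
  (forall i, a' i + b' i = - 2 * (a i * b i)) ->
  \sum_i g i * (a' i * b' i) = 0 ->
  1 <= N -> \sum_i a i ^+ 2 <= N ^+ 2 -> \sum_i b i ^+ 2 <= N ^+ 2 ->
  0 <= sg -> 0 <= kp <= 1 -> sg ^+ 2 = kp * (2 - kp) -> sg * N <= theta / 8 ->
  [/\ forall i, 0 < 1 - sg * a i + kp * a' i,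
      forall i, 0 < 1 - sg * b i + kp * b' i &
      \sum_i (g i * ((1 - sg * a i + kp * a' i) * (1 - sg * b i + kp * b' i))
               - (1 - sg) * mu) ^+ 2 <= (2 * theta * (1 - sg) * mu) ^+ 2].
Proof.
move=> mu0 /andP[th0 th1] glo gmu ab1 a'b' ga'b' N1 aN bN sg0 /andP[kp0 kp1] sgkp y8.
have ghi i : g i <= (1 + theta) * mu.
  have h : (g i - mu) ^+ 2 <= (theta * mu) ^+ 2.
    by apply: le_trans gmu; rewrite (bigD1 i) //= lerDl sumr_ge0 // => j _; exact: sqr_ge0.
  have : g i - mu <= theta * mu.
    by apply: le_of_sqr h; rewrite mulr_ge0 // ltW.
  lra.
have g0 i : 0 <= g i by apply: le_trans (glo i); rewrite mulr_ge0 // ?ltW //; lra.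
pose y := sg * N; have yth : y <= theta / 8 by [].
have th32 : 1 + theta <= 3 / 2 by lra.
have y0 : 0 <= y by rewrite mulr_ge0 //; lra.
have N0 : 0 < N by lra.
have sgy : sg <= y by rewrite ler_peMr.
have y16 : y <= 1 / 16 by rewrite /y; lra.
have kpsg : kp <= sg ^+ 2 by rewrite sgkp ler_peMr //; lra.
have kpy : kp * N ^+ 2 <= y ^+ 2.
  by rewrite /y exprMn ler_wpM2r // sqr_ge0.
have sqle (f : 'I_n -> R) (M : R) i : \sum_i f i ^+ 2 <= M -> f i ^+ 2 <= M.
  by apply: le_trans; rewrite (bigD1 i) //= lerDl sumr_ge0 // => j _; exact: sqr_ge0.
(* Squaring [a' + b' = - 2 * (a * b)] with weights [g], the cross term vanishes by orthogonality.
   The ratio of [1 + theta] to [1 - theta] is below 3, hence [12 = 4 * 3]. *)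
have a'b'N : \sum_i (a' i ^+ 2 + b' i ^+ 2) <= 12 * N ^+ 4.
  have h1 : (1 - theta) * mu * \sum_i (a' i ^+ 2 + b' i ^+ 2) <=
            \sum_i g i * (a' i ^+ 2 + b' i ^+ 2).
    by rewrite mulr_sumr; apply: ler_sum => i _; rewrite ler_wpM2r // addr_ge0 // sqr_ge0.
  have h2 : \sum_i g i * (a' i ^+ 2 + b' i ^+ 2) = \sum_i g i * (4 * (a i ^+ 2 * b i ^+ 2)).
    transitivity (\sum_i g i * (4 * (a i ^+ 2 * b i ^+ 2)) - 2 * \sum_i g i * (a' i * b' i)).
      rewrite mulr_sumr -sumrB; apply: eq_bigr => i _.
      have -> : 4 * (a i ^+ 2 * b i ^+ 2) = (a' i + b' i) ^+ 2 by rewrite a'b'; ring.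
      by ring.
    by rewrite ga'b' mulr0 subr0.
  have h3 : \sum_i g i * (4 * (a i ^+ 2 * b i ^+ 2)) <=
      \sum_i (1 + theta) * mu * 4 * N ^+ 2 * b i ^+ 2.
    apply: ler_sum => i _.
    rewrite [leRHS](_ : _ = (1 + theta) * mu * (4 * (N ^+ 2 * b i ^+ 2))); last by ring.
    rewrite ler_pM ?(mulr_ge0 _ (mulr_ge0 (sqr_ge0 _) (sqr_ge0 _))) //.
    by rewrite ler_pM2l // ler_wpM2r ?sqr_ge0 // (sqle a).
  have h4 : \sum_i (1 + theta) * mu * 4 * N ^+ 2 * b i ^+ 2 <= (1 + theta) * mu * 4 * N ^+ 4.
    rewrite -mulr_sumr [leRHS](_ : _ = (1 + theta) * mu * 4 * N ^+ 2 * N ^+ 2); last by ring.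
    have c0 : 0 <= (1 + theta) * mu * 4 by rewrite !mulr_ge0 //; lra.
    by rewrite ler_wpM2l // mulr_ge0 // sqr_ge0.
  have h5 : (1 - theta) * mu * \sum_i (a' i ^+ 2 + b' i ^+ 2) <=
      (1 - theta) * mu * (12 * N ^+ 4).
    apply: (le_trans h1); rewrite h2; apply: (le_trans h3); apply: (le_trans h4).
    rewrite -subr_ge0.
    have -> : (1 - theta) * mu * (12 * N ^+ 4) - (1 + theta) * mu * 4 * N ^+ 4
       = mu * N ^+ 4 * (8 * (1 - 2 * theta)) by ring.
    by rewrite mulr_ge0 ?(mulr_ge0 (ltW mu0) (exprn_ge0 4 (ltW N0))) //; lra.
  by rewrite -(ler_pM2l (_ : 0 < (1 - theta) * mu)) // mulr_gt0 //; lra.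
have y2 : y ^+ 2 <= y / 16 by rewrite expr2; nra.
(* The two perturbations are at most [y] and [4 * y ^+ 2], whose sum is below 1 since
   [y <= 1 / 16]. *)
have pos (f f' : 'I_n -> R) i : f i ^+ 2 <= N ^+ 2 -> f' i ^+ 2 <= 12 * N ^+ 4 ->
    0 < 1 - sg * f i + kp * f' i.
  move=> fN f'N.
  have h1 : f i <= N by apply: le_of_sqr fN; lra.
  have h2 : - f' i <= 4 * N ^+ 2.
    have N2 : 0 <= 4 * N ^+ 2 by rewrite mulr_ge0 // sqr_ge0.
    apply: le_of_sqr N2 _; rewrite sqrrN.
    apply: (le_trans f'N); rewrite (_ : (4 * N ^+ 2) ^+ 2 = 16 * N ^+ 4); last by ring.
    by rewrite ler_wpM2r ?exprn_ge0 //; lra.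
  have h3 : sg * f i <= y by rewrite ler_wpM2l.
  have h4 : kp * - f' i <= 4 * y ^+ 2.
    by apply: le_trans (_ : kp * (4 * N ^+ 2) <= _); [rewrite ler_wpM2l | lra].
  lra.
have a'N i : a' i ^+ 2 <= 12 * N ^+ 4.
  apply: (sqle a'); apply: le_trans a'b'N; apply: ler_sum => j _.
  by rewrite lerDl sqr_ge0.
have b'N i : b' i ^+ 2 <= 12 * N ^+ 4.
  apply: (sqle b'); apply: le_trans a'b'N; apply: ler_sum => j _.
  by rewrite lerDr sqr_ge0.
split=> [i|i|]; [exact: pos (sqle _ _ _ aN) (a'N i)|exact: pos (sqle _ _ _ bN) (b'N i)|].
(* [e] is the part of the product of the relative factors beyond [1 - sg]. The coefficient of
   [a * b] is [sg ^+ 2 - 2 * kp = - kp ^+ 2], so only terms of order three or more in [sg]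
   remain. *)
pose e i : R := - kp ^+ 2 * (a i * b i) - sg * kp * (a i * b' i + a' i * b i)
            + kp ^+ 2 * (a' i * b' i).
pose t i := kp ^+ 2 / 2 * (a i ^+ 2 + b i ^+ 2)
  + sg * kp / 2 * (N * (a i ^+ 2 + b i ^+ 2) + (a' i ^+ 2 + b' i ^+ 2) / N)
  + kp ^+ 2 / 2 * (a' i ^+ 2 + b' i ^+ 2).
have t0 i : 0 <= t i.
  have ab0 := addr_ge0 (sqr_ge0 (a i)) (sqr_ge0 (b i)).
  have a'b'0 := addr_ge0 (sqr_ge0 (a' i)) (sqr_ge0 (b' i)).
  rewrite /t !addr_ge0 // mulr_ge0 ?divr_ge0 ?sqr_ge0 ?(mulr_ge0 sg0) //.
  by rewrite addr_ge0 // ?divr_ge0 ?mulr_ge0 // ltW.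
have amgm (u v : R) : `|u * v| <= (u ^+ 2 + v ^+ 2) / 2.
  by have := young_norm u v ltr01; rewrite mul1r divr1.
have amgmN (u v : R) := young_norm u v N0.
have et i : `|e i| <= t i.
  have h1 := amgm (a i) (b i); have h2 := amgm (a' i) (b' i).
  have h3 := amgmN (a i) (b' i); have h4 := amgmN (b i) (a' i).
  have k0 : 0 <= sg * kp by rewrite mulr_ge0.
  have h34 : `|a i * b' i + a' i * b i| <=
      (N * (a i ^+ 2 + b i ^+ 2) + (a' i ^+ 2 + b' i ^+ 2) / N) / 2.
    by apply: (le_trans (ler_normD _ _)); rewrite (mulrC (a' i)); lra.
  rewrite /e; apply: (le_trans (ler_normD _ _)).
  apply: (le_trans (lerD (ler_normB _ _) (lexx _))).
  rewrite mulNr normrN !(normrM (kp ^+ 2)) (normrM (sg * kp)).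
  rewrite (ger0_norm k0) (ger0_norm (sqr_ge0 kp)) /t.
  have := ler_wpM2l (sqr_ge0 kp) h1; have := ler_wpM2l (sqr_ge0 kp) h2.
  have := ler_wpM2l k0 h34; lra.
have tS : \sum_i t i <= 14 * y ^+ 3.
  have -> : \sum_i t i = kp ^+ 2 / 2 * (\sum_i a i ^+ 2 + \sum_i b i ^+ 2)
    + sg * kp / 2 * (N * (\sum_i a i ^+ 2 + \sum_i b i ^+ 2)
        + (\sum_i (a' i ^+ 2 + b' i ^+ 2)) / N)
    + kp ^+ 2 / 2 * (\sum_i (a' i ^+ 2 + b' i ^+ 2)).
    by rewrite -!big_split /= mulr_suml !mulr_sumr -!big_split /= mulr_sumr -!big_split.
  set Sa := \sum_i a i ^+ 2 in aN *; set Sb := \sum_i b i ^+ 2 in bN *.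
  set W := \sum_i _ in a'b'N *.
  have k2N4 : kp ^+ 2 * N ^+ 4 <= y ^+ 4.
    have -> : kp ^+ 2 * N ^+ 4 = (kp * N ^+ 2) ^+ 2 by ring.
    have -> : y ^+ 4 = (y ^+ 2) ^+ 2 by ring.
    by rewrite ler_sqr ?nnegrE ?(mulr_ge0 kp0) ?sqr_ge0.
  have k2N2 : kp ^+ 2 * N ^+ 2 <= y ^+ 4.
    apply: le_trans k2N4; rewrite ler_wpM2l ?sqr_ge0 //.
    rewrite -[leLHS]mulr1 (_ : N ^+ 4 = N ^+ 2 * N ^+ 2); last by ring.
    by rewrite ler_wpM2l ?sqr_ge0 ?exprn_ege1.
  have skN3 : sg * kp * N ^+ 3 <= y ^+ 3.
    have -> : sg * kp * N ^+ 3 = y * (kp * N ^+ 2) by rewrite /y; ring.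
    by rewrite [leRHS]exprS ler_wpM2l.
  have WN : W / N <= 12 * N ^+ 3.
    rewrite ler_pdivrMr //; apply: (le_trans a'b'N); lra.
  have h1 : kp ^+ 2 / 2 * (Sa + Sb) <= y ^+ 4.
    apply: le_trans (_ : kp ^+ 2 / 2 * (2 * N ^+ 2) <= _); last by lra.
    by rewrite ler_wpM2l ?divr_ge0 ?sqr_ge0 //; lra.
  have h2 : sg * kp / 2 * (N * (Sa + Sb) + W / N) <= 7 * y ^+ 3.
    apply: le_trans (_ : sg * kp / 2 * (14 * N ^+ 3) <= _); last by lra.
    rewrite ler_wpM2l ?divr_ge0 ?mulr_ge0 //.
    have : N * (Sa + Sb) <= N * (2 * N ^+ 2) by rewrite ler_pM2l //; lra.
    lra.
  have h3 : kp ^+ 2 / 2 * W <= 6 * y ^+ 4.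
    apply: le_trans (_ : kp ^+ 2 / 2 * (12 * N ^+ 4) <= _); last by lra.
    by rewrite ler_wpM2l ?divr_ge0 ?sqr_ge0.
  have : y ^+ 4 <= y ^+ 3 by rewrite exprSr ler_piMr ?exprn_ge0 //; lra.
  lra.
have y3 : y ^+ 3 <= y / 256.
  have -> : y ^+ 3 = y * y ^+ 2 by ring.
  have -> : y / 256 = y * (1 / 256) by ring.
  by rewrite ler_wpM2l //; lra.
(* The left side is at most [21 * y ^+ 3 * mu], with [y ^+ 3 <= y / 256] and [y <= theta / 8], while
   [1 - sg >= 15 / 16]. *)
have gtS : \sum_i g i * t i <= theta * (1 - sg) * mu.
  apply: le_trans (_ : (1 + theta) * mu * (14 * y ^+ 3) <= _).
    apply: le_trans (_ : \sum_i (1 + theta) * mu * t i <= _).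
      by apply: ler_sum => i _; rewrite ler_wpM2r.
    by rewrite -mulr_sumr ler_wpM2l // mulr_ge0 //; lra.
  rewrite -[_ * mu * _]mulrA (mulrC mu) mulrA ler_pM2r //.
  have h0 : 0 <= y ^+ 3 by rewrite exprn_ge0.
  apply: le_trans (_ : 3 / 2 * (14 * y ^+ 3) <= _).
    by rewrite ler_wpM2r // (mulr_ge0 _ h0).
  apply: le_trans (_ : theta * (15 / 16) <= _); last by rewrite ler_pM2l //; lra.
  lra.
have geS : \sum_i (g i * e i) ^+ 2 <= (theta * (1 - sg) * mu) ^+ 2.
  apply: le_trans (_ : \sum_i (g i * t i) ^+ 2 <= _).
    apply: ler_sum => i _; rewrite -[leLHS]real_normK ?num_real // normrM (ger0_norm (g0 i)).
    by rewrite ler_sqr ?nnegrE ?mulr_ge0 // ler_wpM2l.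
  apply: le_trans (sum_sqr_le_sqr_sum (fun i => mulr_ge0 (g0 i) (t0 i))) _.
  have gt0 : 0 <= \sum_i g i * t i by apply: sumr_ge0 => i _; rewrite mulr_ge0.
  by rewrite ler_sqr ?nnegrE // (le_trans gt0 gtS).
(* By [(u + v) ^+ 2 <= 2 * u ^+ 2 + 2 * v ^+ 2], the arc error and the initial decentering may each
   use a radius [theta * (1 - sg) * mu]; together they fill the doubled neighborhood. *)
apply: le_trans (_ : \sum_i (2 * (g i * e i) ^+ 2 + 2 * (1 - sg) ^+ 2 * (g i - mu) ^+ 2) <= _).
  apply: ler_sum => i _.
  have -> : g i * ((1 - sg * a i + kp * a' i) * (1 - sg * b i + kp * b' i)) - (1 - sg) * mu
     = g i * e i + (1 - sg) * (g i - mu).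
    have -> : (1 - sg * a i + kp * a' i) * (1 - sg * b i + kp * b' i) = 1 - sg + e i.
      have -> : (1 - sg * a i + kp * a' i) * (1 - sg * b i + kp * b' i) =
        1 - sg * (a i + b i) + kp * (a' i + b' i) + sg ^+ 2 * (a i * b i)
        - sg * kp * (a i * b' i + a' i * b i) + kp ^+ 2 * (a' i * b' i) by ring.
      by rewrite ab1 a'b' sgkp /e; ring.
    by ring.
  rewrite -subr_ge0.
  have -> : 2 * (g i * e i) ^+ 2 + 2 * (1 - sg) ^+ 2 * (g i - mu) ^+ 2 -
   (g i * e i + (1 - sg) * (g i - mu)) ^+ 2 = (g i * e i - (1 - sg) * (g i - mu)) ^+ 2 by ring.
  exact: sqr_ge0.
rewrite big_split /= -!mulr_sumr.
have := ler_wpM2l (sqr_ge0 (1 - sg)) gmu; lra.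
Qed.

(** Pythagoras in the [g]-weighted inner product: after the shifts by [p] and [q] the two families
    are orthogonal, so their squared norms add up to that of [1 - p - q]. *)
Lemma relative_direction_bound (R : realType) (n : nat) (g a b p q : 'I_n -> R)
    (mu theta T : R) :
  0 < mu -> 0 < theta < 2^-1 -> (forall i, (1 - theta) * mu <= g i) ->
  \sum_i g i <= T * mu -> (forall i, a i + b i = 1) ->
  \sum_i g i * ((a i - p i) * (b i - q i)) = 0 ->
  \sum_i g i * p i ^+ 2 <= T * mu -> \sum_i g i * q i ^+ 2 <= T * mu ->
  \sum_i a i ^+ 2 <= 40 * T /\ \sum_i b i ^+ 2 <= 40 * T.
Proof.
move=> mu0 /andP[th0 th1] glo gT ab1 orth pT qT.
have g0 i : 0 <= g i by apply: le_trans (glo i); rewrite mulr_ge0 // ?ltW //; lra.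
have h1 : \sum_i g i * ((a i - p i) ^+ 2 + (b i - q i) ^+ 2) <= 9 * T * mu.
  have -> : \sum_i g i * ((a i - p i) ^+ 2 + (b i - q i) ^+ 2) =
      \sum_i g i * (1 - p i - q i) ^+ 2.
    rewrite -[RHS]subr0 -[X in _ = _ - X](mulr0 2) -[X in _ = _ - 2 * X]orth mulr_sumr -sumrB.
    apply: eq_bigr => i _.
    have -> : 1 - p i - q i = (a i - p i) + (b i - q i) by have := ab1 i; lra.
    by ring.
  apply: le_trans (_ : \sum_i (3 * g i + 3 * (g i * p i ^+ 2) + 3 * (g i * q i ^+ 2)) <= _).
    apply: ler_sum => i _.
    rewrite [leRHS](_ : _ = g i * (3 * (1 + p i ^+ 2 + q i ^+ 2))); last by ring.
    rewrite ler_wpM2l //.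
    have := sqr_ge0 (1 + p i); have := sqr_ge0 (1 + q i); have := sqr_ge0 (p i - q i); lra.
  rewrite !big_split /= -!mulr_sumr; lra.
(* [40 = 4 * 9 + 4]: since [mu <= 2 * g], it suffices to bound [2 * g * f ^+ 2], and [f] is split as
   [(f - r) + r]. *)
have half (f r : 'I_n -> R) :
    \sum_i g i * (f i - r i) ^+ 2 <= 9 * T * mu -> \sum_i g i * r i ^+ 2 <= T * mu ->
    \sum_i f i ^+ 2 <= 40 * T.
  move=> fr rT; rewrite -(ler_pM2l mu0).
  apply: le_trans (_ : \sum_i (4 * (g i * (f i - r i) ^+ 2) + 4 * (g i * r i ^+ 2)) <= _).
    rewrite mulr_sumr; apply: ler_sum => i _.
    apply: le_trans (_ : 2 * g i * f i ^+ 2 <= _).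
      rewrite ler_wpM2r ?sqr_ge0 //; apply: le_trans (_ : 2 * ((1 - theta) * mu) <= _).
        by rewrite mulrA ler_peMl ?ltW //; lra.
      by rewrite ler_pM2l.
    rewrite -subr_ge0 [X in 0 <= X](_ : _ = 2 * (g i * (f i - 2 * r i) ^+ 2)); last by ring.
    by rewrite mulr_ge0 // mulr_ge0 // sqr_ge0.
  rewrite big_split /= -!mulr_sumr; lra.
split; [apply: half pT|apply: half qT]; apply: le_trans h1; apply: ler_sum => i _.
  by rewrite ler_wpM2l // lerDl sqr_ge0.
by rewrite ler_wpM2l // lerDr sqr_ge0.
Qed.

(** Bounding squares by the square of the sum makes a bound on the plain sum suffice, the form in
    which [weighted_infeasibility_bound] controls the residual terms. *)
Lemma sum_sqr_div_le (R : realType) (n : nat) (g h k : 'I_n -> R) (mu S : R) :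
  0 < mu -> (forall i, mu / 2 <= g i) -> (forall i, `|h i| <= k i) ->
  \sum_i k i <= S ->
  \sum_i g i * (h i / g i) ^+ 2 <= 2 * S ^+ 2 / mu.
Proof.
move=> mu0 glo hk kS.
have g0 i : 0 < g i by apply: lt_le_trans (glo i); rewrite divr_gt0.
have k0 i : 0 <= k i by apply: le_trans (hk i).
apply: le_trans (_ : \sum_i 2 / mu * k i ^+ 2 <= _).
  apply: ler_sum => i _.
  have -> : g i * (h i / g i) ^+ 2 = (g i)^-1 * h i ^+ 2 by field; rewrite gt_eqF.
  rewrite ler_pM ?sqr_ge0 ?invr_ge0 ?(ltW (g0 i)) //.
    by rewrite -[2 / mu]invf_div lef_pV2 ?posrE ?divr_gt0.
  by rewrite -[leLHS]real_normK ?num_real // ler_sqr ?nnegrE.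
rewrite -mulr_sumr [leRHS](_ : _ = 2 / mu * S ^+ 2); last by field; rewrite gt_eqF.
rewrite ler_wpM2l ?divr_ge0 ?(ltW mu0) //.
apply: le_trans (sum_sqr_le_sqr_sum k0) _.
by rewrite ler_sqr ?nnegrE ?(le_trans _ kS) ?sumr_ge0.
Qed.

(** * Coordinate forms of the matrix notions and of the neighborhood *)

Lemma dotE (R : realType) (n : nat) (u v : 'cV[R]_n) :
  (u^T *m v) 0 0 = \sum_i u i 0 * v i 0.
Proof. by rewrite mxE; apply: eq_bigr => i _; rewrite mxE. Qed.

Lemma diagE (R : realType) (n : nat) (u v : 'cV[R]_n) i :
  (diag u *m v) i 0 = u i 0 * v i 0.
Proof. by rewrite /diag mul_diag_mx !mxE. Qed.

Lemma diag_newtonE (R : realType) (n : nat) (x s dx ds v : 'cV[R]_n) i :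
  diag s *m dx + diag x *m ds = v ->
  s i 0 * dx i 0 + x i 0 * ds i 0 = v i 0.
Proof. by move=> <-; rewrite mxE !diagE. Qed.

Lemma kernel_range_orthogonal (R : realType) (m n : nat) (A : 'M[R]_(m, n))
    (u v : 'cV[R]_n) (l : 'cV[R]_m) :
  A *m u = 0 -> A^T *m l + v = 0 -> \sum_i u i 0 * v i 0 = 0.
Proof.
move=> Au /eqP; rewrite addrC addr_eq0 => /eqP ->.
by rewrite -dotE mulmxN mulmxA -trmx_mul Au trmx0 mul0mx !mxE oppr0.
Qed.

Lemma dualityE (R : realType) (n : nat) (x s : 'cV[R]_n) :
  (0 < n)%N -> \sum_i x i 0 * s i 0 = n%:R * duality_measure x s.
Proof.
move=> n0; rewrite /duality_measure dotE mulrCA divff ?mulr1 //.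
by rewrite pnatr_eq0 -lt0n.
Qed.

Lemma duality_gt0 (R : realType) (n : nat) (x s : 'cV[R]_n) :
  (0 < n)%N -> vpos x -> vpos s -> 0 < duality_measure x s.
Proof.
case: n x s => // n x s _ /forallP x0 /forallP s0.
rewrite /duality_measure dotE divr_gt0 ?ltr0n // big_ord_recl.
by rewrite ltr_pwDl ?mulr_gt0 // sumr_ge0 // => i _; rewrite mulr_ge0 // ltW.
Qed.

Lemma neighborhoodP (R : realType) (m n : nat) (theta : R) (w : iterate R m n) :
  (0 < n)%N -> 0 < theta ->
  reflect [/\ vpos (xpart w), vpos (spart w) &
    \sum_i (xpart w i 0 * spart w i 0 - mu w) ^+ 2 <= (theta * mu w) ^+ 2]
  (neighborhood theta w).
Proof.
move=> n0 th0; have t0 : vpos (xpart w) -> vpos (spart w) -> 0 <= theta * mu w.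
  by move=> x0 s0; rewrite mulr_ge0 // ltW // duality_gt0.
have sumE : \sum_i (cprod (xpart w) (spart w) - mu w *: ones) i 0 ^+ 2 =
    \sum_i (xpart w i 0 * spart w i 0 - mu w) ^+ 2.
  by apply: eq_bigr => i _; rewrite !mxE mulr1.
by apply: (iffP and3P) => -[x0 s0 h]; split=> //; move: h; rewrite norm2_le ?t0 // sumE.
Qed.

Lemma near_lower_bound (R : realType) (n : nat) (g : 'I_n -> R) (theta mu : R) i :
  0 <= theta * mu -> \sum_j (g j - mu) ^+ 2 <= (theta * mu) ^+ 2 ->
  (1 - theta) * mu <= g i.
Proof.
move=> t0 h; have : mu - g i <= theta * mu; last by lra.
apply: le_of_sqr t0 _; apply: le_trans h.
rewrite (bigD1 i) //= -sqrrN opprB lerDl sumr_ge0 // => j _; exact: sqr_ge0.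
Qed.

Lemma vposP (R : realType) (n : nat) (v : 'cV[R]_n) :
  reflect (forall i, 0 < v i 0) (vpos v).
Proof. exact: forallP. Qed.

(** * Size of the first derivatives *)

(** [z] has the same primal residual as [eta *: x0 + (1 - eta) *: xs], and [s] matches the analogous
    dual combination with [nu], so the differences are orthogonal. Expanding this isolates the
    wanted sums; complementarity removes [xs * ss], and [rho] bounds the cross terms. *)
Lemma weighted_infeasibility_bound (R : realType) (m n : nat) (A : 'M[R]_(m, n))
    (b : 'cV[R]_m) (c : 'cV[R]_n) (rho eta nu : R) (w0 ws : iterate R m n)
    (z : 'cV[R]_n) (l : 'cV[R]_m) (s : 'cV[R]_n) :
  (0 < n)%N -> 1 <= rho -> vpos (xpart w0) -> vpos (spart w0) ->
  primal_dual_optimal A b c ws ->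
  vle (xpart ws) (rho *: xpart w0) -> vle (spart ws) (rho *: spart w0) ->
  vpos z -> vpos s -> 0 <= eta -> eta <= nu -> nu <= 1 ->
  r_b A b z = eta *: r_b A b (xpart w0) ->
  r_c A c l s = nu *: r_c A c (lpart w0) (spart w0) ->
  eta * (\sum_i xpart w0 i 0 * s i 0) + nu * (\sum_i z i 0 * spart w0 i 0) <=
    n%:R * (duality_measure z s + (1 + 2 * rho) * (nu * mu w0)).
Proof.
case: w0 ws => x0 l0 s0 [xs ls ss] /= n0 rho1 /vposP x00 /vposP s00.
case=> /= Axs Als /forallP xs0 /forallP ss0 xss0 /forallP xsr /forallP ssr.
move=> /vposP z0 /vposP sp eta0 etanu nu1 rb rc.
have orth : \sum_i (eta *: x0 + (1 - eta) *: xs - z) i 0 *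
                   (nu *: s0 + (1 - nu) *: ss - s) i 0 = 0.
  apply: (@kernel_range_orthogonal _ _ _ A _ _ (nu *: l0 + (1 - nu) *: ls - l)).
    rewrite mulmxBr mulmxDr -!scalemxAr Axs.
    move/eqP: rb; rewrite /r_b subr_eq => /eqP ->.
    by apply/matrixP => i j; rewrite !mxE; ring.
  rewrite mulmxBr mulmxDr -!scalemxAr.
  have -> : A^T *m ls = c - ss by rewrite -Als addrK.
  have -> : A^T *m l = nu *: (A^T *m l0 + s0 - c) + c - s.
    by rewrite -[nu *: _]rc /r_c subrK addrK.
  by apply/matrixP => i j; rewrite !mxE; ring.
have := dualityE z s n0; have := dualityE x0 s0 n0; rewrite /mu /= => dx dz.
rewrite [leRHS](_ : _ = \sum_i z i 0 * s i 0 + (1 + 2 * rho) * nu * \sum_i x0 i 0 * s0 i 0);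
  last by rewrite dx dz; ring.
rewrite -[leRHS]subr0 -[X in _ <= _ - X]orth !mulr_sumr -big_split -sumrN -!big_split /=.
apply: ler_sum => i _; rewrite !mxE -subr_ge0.
have := xs0 i; have := ss0 i; have := xsr i; have := ssr i; have := x00 i; have := s00 i.
have := z0 i; have := sp i; have := xss0 i; rewrite !mxE.
set X := x0 i 0; set Y := s0 i 0; set xi := xs i 0; set si := ss i 0.
set zi := z i 0; set ti := s i 0 => xis ti0 zi0 Y0 X0 siY xiX si0 xi0.
have nu0 : 0 <= nu by lra.
rewrite [X in 0 <= X](_ : _ = nu * ((1 - eta) * (X * Y) + 2 * rho * (X * Y))
  - eta * (1 - nu) * (X * si) - (1 - eta) * nu * (xi * Y)
  + (1 - eta) * (xi * ti) + (1 - nu) * (zi * si) - (1 - eta) * (1 - nu) * (xi * si)); last by ring.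
rewrite xis mulr0 subr0.
have XY0 : 0 < X * Y by rewrite mulr_gt0.
have h1 : X * si <= rho * (X * Y) by rewrite mulrCA ler_pM2l.
have h2 : xi * Y <= rho * (X * Y) by rewrite mulrA ler_pM2r.
have e1 : 0 <= 1 - eta by lra.
have n1 : 0 <= 1 - nu by lra.
(* Here [eta <= nu] enters: it lets the primal multiple be replaced by the dual one. *)
have h3 : eta * (1 - nu) * (X * si) <= nu * (rho * (X * Y)).
  apply: ler_pM; rewrite ?mulr_ge0 ?(ltW X0) //.
  by apply: le_trans etanu; rewrite ler_piMr //; lra.
have h4 : (1 - eta) * nu * (xi * Y) <= nu * (rho * (X * Y)).
  by apply: ler_pM; rewrite ?mulr_ge0 ?(ltW Y0) // ler_piMl //; lra.
have h5 : 0 <= (1 - eta) * (xi * ti) by rewrite !mulr_ge0 // ltW.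
have h6 : 0 <= (1 - nu) * (zi * si) by rewrite !mulr_ge0 // ltW.
have h7 : 0 <= nu * ((1 - eta) * (X * Y)) by rewrite !mulr_ge0 // ltW.
lra.
Qed.

(** Subtracting [eta *: (x0 - xs)] and [nu *: (s0 - ss)] leaves directions in the kernel and the row
    space of [A], so [relative_direction_bound] applies. [K] allows the duality measure at a restart
    point to be below [nu * mu w0]. *)
Lemma first_derivative_bound (R : realType) (m n : nat) (A : 'M[R]_(m, n))
    (b : 'cV[R]_m) (c : 'cV[R]_n) (theta rho eta nu K : R) (w0 ws w d : iterate R m n)
    (z : 'cV[R]_n) :
  (0 < n)%N -> 0 < theta < 2^-1 -> 1 <= rho -> vpos (xpart w0) -> vpos (spart w0) ->
  primal_dual_optimal A b c ws ->
  vle (xpart ws) (rho *: xpart w0) -> vle (spart ws) (rho *: spart w0) ->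
  neighborhood theta (Iterate z (lpart w) (spart w)) ->
  0 <= eta -> eta <= nu -> nu <= 1 ->
  r_b A b z = eta *: r_b A b (xpart w0) ->
  r_c A c (lpart w) (spart w) = nu *: r_c A c (lpart w0) (spart w0) ->
  1 <= K -> nu * mu w0 <= K * duality_measure z (spart w) ->
  first_derivative A b c z w d ->
  \sum_i (xpart d i 0 / z i 0) ^+ 2 <= (36 * rho ^+ 2 * K * n%:R) ^+ 2 /\
  \sum_i (spart d i 0 / spart w i 0) ^+ 2 <= (36 * rho ^+ 2 * K * n%:R) ^+ 2.
Proof.
move=> n0 th rho1 x00 s00 opt xsr ssr nb eta0 etanu nu1 rb rc K1 nuK [Ad Ald newton].
have th0 : 0 < theta by case/andP: th.
case/(neighborhoodP _ n0 th0): nb => /=; rewrite /mu /= => zp sp near.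
have bound := weighted_infeasibility_bound n0 rho1 x00 s00 opt xsr ssr zp sp
  eta0 etanu nu1 rb rc.
have mu0 := duality_gt0 n0 zp sp.
have sumg := dualityE z (spart w) n0.
move: w0 ws w d x00 s00 opt xsr ssr rb rc Ad Ald newton zp sp bound mu0 sumg nuK near.
case=> x0 l0 s0 [xs ls ss] [x l s] [dx dl ds] /=.
move=> /vposP x00 /vposP s00 [/= Axs Als /forallP xs0 /forallP ss0 _] /forallP xsr /forallP ssr.
move=> rb rc Ad Ald newton /vposP zp /vposP sp.
rewrite /mu /=; set M := duality_measure z s => bound mu0 sumg nuK near.
have tM : 0 <= theta * M by rewrite ltW // mulr_gt0.
have glo i := near_lower_bound i tM near.
have nR : 1 <= n%:R :> R by rewrite ler1n.
(* The factor [4 * rho * K] absorbs [1 + (1 + 2 * rho) * K], as [rho] and [K] are at least 1. *)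
pose S := 4 * rho * K * n%:R * M.
have rK : rho <= rho * K by rewrite ler_peMr //; lra.
have KrK : K <= rho * K by rewrite ler_peMl //; lra.
have boundS : eta * (\sum_i x0 i 0 * s i 0) + nu * (\sum_i z i 0 * s0 i 0) <= S.
  apply: le_trans bound _.
  rewrite /S (_ : 4 * _ * _ * _ * M = n%:R * (4 * rho * K * M)); last by ring.
  rewrite ler_wpM2l ?ler0n //.
  have h : (1 + 2 * rho) * (nu * duality_measure x0 s0) <= (1 + 2 * rho) * (K * M).
    by rewrite ler_wpM2l //; lra.
  have : M * (1 + K) <= M * (2 * (rho * K)) by rewrite ler_pM2l //; lra.
  lra.
have nonneg e (u v : 'cV[R]_n) : 0 <= e -> (forall i, 0 < u i 0) -> (forall i, 0 < v i 0) ->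
    0 <= e * \sum_i u i 0 * v i 0.
  by move=> e0 u0 v0; rewrite mulr_ge0 // sumr_ge0 // => i _; rewrite mulr_ge0 // ltW.
have nu0 : 0 <= nu by lra.
have n1 := nonneg _ _ _ eta0 x00 sp; have n2 := nonneg _ _ _ nu0 zp s00.
(* [p] and [q] are the shifts relative to [z] and [s], over the common denominator [z * s] required
   by [sum_sqr_div_le]. *)
pose p i := s i 0 * (eta * (x0 i 0 - xs i 0)) / (z i 0 * s i 0).
pose q i := z i 0 * (nu * (s0 i 0 - ss i 0)) / (z i 0 * s i 0).
pose T := 32 * rho ^+ 4 * K ^+ 2 * n%:R ^+ 2.
have ST : 2 * (rho * S) ^+ 2 / M = T * M by rewrite /S /T; field; rewrite gt_eqF.
have absle (u v r : R) : 0 <= v -> v <= rho * u -> 0 < u -> 0 <= r ->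
    `|r * (u - v)| <= rho * (r * u).
  move=> v0 vu u0 r0; rewrite normrM (ger0_norm r0) mulrCA ler_wpM2l //.
  have uu : u <= rho * u by rewrite ler_peMl // ltW.
  by rewrite ler_norml; apply/andP; split; lra.
have g2 i : M / 2 <= z i 0 * s i 0.
  apply: le_trans (glo i); rewrite mulrC ler_pM2r //; case/andP: th => *; lra.
have pT : \sum_i z i 0 * s i 0 * p i ^+ 2 <= T * M.
  rewrite -ST; apply: (@sum_sqr_div_le _ _ _ _ (fun i => rho * (eta * (x0 i 0 * s i 0)))) => //.
    move=> i; rewrite mulrA [eta * (_ * _)](_ : _ = s i 0 * eta * x0 i 0); last by ring.
    apply: absle => //; last by rewrite mulr_ge0 // ltW.
      by have := xs0 i; rewrite mxE.
    by have := xsr i; rewrite mxE.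
  by rewrite -!mulr_sumr ler_wpM2l //; lra.
have qT : \sum_i z i 0 * s i 0 * q i ^+ 2 <= T * M.
  rewrite -ST; apply: (@sum_sqr_div_le _ _ _ _ (fun i => rho * (nu * (z i 0 * s0 i 0)))) => //.
    move=> i; rewrite mulrA [nu * (_ * _)](_ : _ = z i 0 * nu * s0 i 0); last by ring.
    apply: absle => //; last by rewrite mulr_ge0 // ltW.
      by have := ss0 i; rewrite mxE.
    by have := ssr i; rewrite mxE.
  by rewrite -!mulr_sumr ler_wpM2l //; lra.
have gT : \sum_i z i 0 * s i 0 <= T * M.
  rewrite sumg ler_pM2r //.
  have r4 : 1 <= rho ^+ 4 by rewrite exprn_ege1.
  have k2 : 1 <= K ^+ 2 by rewrite exprn_ege1.
  have nn2 : n%:R <= n%:R ^+ 2 :> R by rewrite expr2 ler_peMl //; lra.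
  apply: le_trans nn2 _; rewrite /T ler_peMl ?sqr_ge0 //.
  have : 1 <= rho ^+ 4 * K ^+ 2 by rewrite mulr_ege1.
  lra.
have ab1 i : dx i 0 / z i 0 + ds i 0 / s i 0 = 1.
  have := diag_newtonE i newton; rewrite mxE => h; have zn : z i 0 != 0 by rewrite gt_eqF.
  have sn : s i 0 != 0 by rewrite gt_eqF.
  by rewrite -(divff (mulf_neq0 zn sn)) -{1}h; field; rewrite zn sn.
have orth : \sum_i (dx - eta *: (x0 - xs)) i 0 * (ds - nu *: (s0 - ss)) i 0 = 0.
  apply: (@kernel_range_orthogonal _ _ _ A _ _ (dl - nu *: (l0 - ls))).
    by rewrite mulmxBr -scalemxAr mulmxBr Ad rb Axs subrr.
  rewrite mulmxBr -scalemxAr mulmxBr.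
  have -> : A^T *m ls = c - ss by rewrite -Als addrK.
  have -> : A^T *m dl = nu *: r_c A c l0 s0 - ds by rewrite -rc -Ald addrK.
  by rewrite /r_c; apply/matrixP => i j; rewrite !mxE; ring.
have [] := @relative_direction_bound _ _ (fun i => z i 0 * s i 0)
    (fun i => dx i 0 / z i 0) (fun i => ds i 0 / s i 0) p q M theta T mu0 th glo gT ab1 _ pT qT.
  rewrite -[RHS]orth; apply: eq_bigr => i _; rewrite !mxE /p /q; field.
  by rewrite !gt_eqF.
(* With the constant 32 of [T], [40 * 32 = 1280], just below [36 ^+ 2 = 1296]. *)
have T40 : 40 * T <= (36 * rho ^+ 2 * K * n%:R) ^+ 2.
  rewrite -subr_ge0 /T [X in 0 <= X](_ : _ = 16 * (rho ^+ 2 * K * n%:R) ^+ 2); last by ring.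
  by rewrite mulr_ge0 // sqr_ge0.
by move=> h1 h2; split; [apply: le_trans h1 _|apply: le_trans h2 _].
Qed.

(** * Lower bound on the step length *)

(** Dividing the derivatives componentwise by [z] and [s] turns the Newton systems into the scalar
    relations of [arc_estimate]. *)
Lemma arc_admissible_small (R : realType) (m n : nat) (A : 'M[R]_(m, n))
    (b : 'cV[R]_m) (c : 'cV[R]_n) (theta N t : R) (w d1 d2 : iterate R m n) (z : 'cV[R]_n) :
  (0 < n)%N -> 0 < theta < 2^-1 -> 1 <= N ->
  neighborhood theta (Iterate z (lpart w) (spart w)) ->
  first_derivative A b c z w d1 -> second_derivative A z w d1 d2 ->
  \sum_i (xpart d1 i 0 / z i 0) ^+ 2 <= N ^+ 2 ->
  \sum_i (spart d1 i 0 / spart w i 0) ^+ 2 <= N ^+ 2 ->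
  0 < t <= pi / 2 -> sin t * N <= theta / 8 ->
  arc_admissible theta (duality_measure z (spart w)) (Defs.arc z w d1 d2) t.
Proof.
move=> n0 th N1 nb [_ _ nw1] [Ad2 Ald2 nw2] aN bN /andP[t0 tpi] sN.
have th0 : 0 < theta by case/andP: th.
have s0t : 0 <= sin t.
  rewrite sin_ge0_pi // ltW //= (le_trans tpi) // ler_pdivrMr //.
  by rewrite ler_peMr ?pi_ge0 // ler1n.
have c0t : 0 <= cos t by apply: cos_ge0_pihalf; apply/andP; split=> //; have := pi_ge0 R; lra.
case/(neighborhoodP _ n0 th0): nb => /=; rewrite /mu /= => zp sp near.
have mu0 := duality_gt0 n0 zp sp.
move: w d1 d2 sp nw1 Ad2 Ald2 nw2 aN bN near mu0.
case=> x l s [dx dl ds] [ex el es] /= sp nw1 Aex Ael nw2 aN bN.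
set M := duality_measure z s => near mu0.
move/vposP: zp => zp; move/vposP: sp => sp.
have tM : 0 <= theta * M by rewrite ltW // mulr_gt0.
have glo i := near_lower_bound i tM near.
have zn i : z i 0 != 0 by rewrite gt_eqF.
have sn i : s i 0 != 0 by rewrite gt_eqF.
have ab1 i : dx i 0 / z i 0 + ds i 0 / s i 0 = 1.
  have := diag_newtonE i nw1; rewrite mxE => h.
  by rewrite -(divff (mulf_neq0 (zn i) (sn i))) -{1}h; field; rewrite zn sn.
have ab2 i : ex i 0 / z i 0 + es i 0 / s i 0 = - 2 * (dx i 0 / z i 0 * (ds i 0 / s i 0)).
  have := diag_newtonE i nw2; rewrite !mxE => h.
  rewrite (_ : - 2 * _ = (- 2 * (dx i 0 * ds i 0)) / (z i 0 * s i 0)); last by field; rewrite zn sn.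
  by rewrite -h; field; rewrite zn sn.
have orth : \sum_i z i 0 * s i 0 * (ex i 0 / z i 0 * (es i 0 / s i 0)) = 0.
  rewrite -[RHS](kernel_range_orthogonal Aex Ael); apply: eq_bigr => i _.
  by field; rewrite zn sn.
have kp01 : 0 <= 1 - cos t <= 1 by have := cos_le1 t; lra.
have sgkp : sin t ^+ 2 = (1 - cos t) * (2 - (1 - cos t)).
  by have := cos2Dsin2 t; lra.
have [px ps pc] := arc_estimate mu0 th glo near ab1 ab2 orth N1 aN bN s0t kp01 sgkp sN.
have xE i : (z - sin t *: dx + (1 - cos t) *: ex) i 0 =
    z i 0 * (1 - sin t * (dx i 0 / z i 0) + (1 - cos t) * (ex i 0 / z i 0)).
  by rewrite !mxE; field.
have sE i : (s - sin t *: ds + (1 - cos t) *: es) i 0 =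
    s i 0 * (1 - sin t * (ds i 0 / s i 0) + (1 - cos t) * (es i 0 / s i 0)).
  by rewrite !mxE; field.
split=> /=; [by apply/vposP => i; rewrite xE mulr_gt0|by apply/vposP => i; rewrite sE mulr_gt0|].
have sin1 := sin_le1 t.
rewrite norm2_le; last first.
  by rewrite mulr_ge0 ?(ltW mu0) // mulr_ge0 ?subr_ge0 // mulr_ge0 // ltW.
apply: le_trans pc; rewrite le_eqVlt; apply/orP; left; apply/eqP.
apply: eq_bigr => i _; rewrite mxE [X in X + _]mxE xE sE !mxE; ring.
Qed.

(** The angle [asin (theta / 8 / N)] lies in the step range, since sine increases up to [pi / 2] and
    [arc_admissible_small] covers all smaller angles; maximality of [alpha] concludes. *)
Lemma largest_step_lower_bound (R : realType) (m n : nat) (A : 'M[R]_(m, n))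
    (b : 'cV[R]_m) (c : 'cV[R]_n) (theta N alpha : R) (w d1 d2 : iterate R m n)
    (z : 'cV[R]_n) :
  (0 < n)%N -> 0 < theta < 2^-1 -> 1 <= N ->
  neighborhood theta (Iterate z (lpart w) (spart w)) ->
  first_derivative A b c z w d1 -> second_derivative A z w d1 d2 ->
  \sum_i (xpart d1 i 0 / z i 0) ^+ 2 <= N ^+ 2 ->
  \sum_i (spart d1 i 0 / spart w i 0) ^+ 2 <= N ^+ 2 ->
  largest_step theta (duality_measure z (spart w)) (Defs.arc z w d1 d2) alpha ->
  theta / 8 / N <= sin alpha.
Proof.
move=> n0 th N1 nb fd sd aN bN [[/andP[al0 alpi] _] amax].
have [th0 th1] := andP th.
pose t := theta / 8 / N.
have t0 : 0 < t by rewrite !divr_gt0 //; lra.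
have tN : t * N = theta / 8 by rewrite /t divfK // gt_eqF //; lra.
have t1 : t <= 1 by rewrite ler_pdivrMr; lra.
have tin : -1 <= t <= 1 by rewrite t1 andbT; lra.
have [/andP[alo ahi] sint] := asin_def tin.
have pi0 := pi_gt0 R.
have in0 : 0 \in `[- (pi / 2), pi / 2 :> R] by rewrite in_itv /=; lra.
have ina : asin t \in `[- (pi / 2), pi / 2] by rewrite in_itv /= alo ahi.
have inal : alpha \in `[- (pi / 2), pi / 2] by rewrite in_itv /= alpi andbT; lra.
have a0 : 0 < asin t by rewrite -ltr_sin // sin0 sint.
rewrite -/t leNgt -sint ltr_sin // -leNgt; apply: amax; split; first by rewrite a0.
move=> u /andP[u0 ua]; have upi := le_trans ua ahi.
apply: (arc_admissible_small n0 th N1 nb fd sd aN bN); first by rewrite u0.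
have inu : u \in `[- (pi / 2), pi / 2] by rewrite in_itv /= upi andbT; lra.
have su : sin u <= t by rewrite -sint leNgt ltr_sin // -leNgt.
by rewrite -tN ler_wpM2r //; lra.
Qed.

(** * The restart weight *)

Lemma r_b_line (R : realType) (m n : nat) (A : 'M[R]_(m, n)) (b : 'cV[R]_m)
    (t : R) (x y : 'cV[R]_n) :
  r_b A b (x + t *: (x - y)) = r_b A b x + t *: (r_b A b x - r_b A b y).
Proof.
rewrite /r_b mulmxDr -scalemxAr mulmxBr.
by apply/matrixP => i j; rewrite !mxE; ring.
Qed.

Lemma restart_weight_ge0 (R : realType) (m n : nat) (A : 'M[R]_(m, n)) (b : 'cV[R]_m)
    (beta : R) (xprev x : 'cV[R]_n) :
  0 <= beta -> 0 <= restart_weight A b beta xprev x.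
Proof. by move=> b0; apply: le_bigmin => [|i _]; rewrite ?divr_ge0. Qed.

(** This is the effect of the first term of the minimum; it later keeps the duality measure above
    [1 - beta] times its old value. *)
Lemma restart_weight_relative (R : realType) (m n : nat) (A : 'M[R]_(m, n))
    (b : 'cV[R]_m) (beta : R) (xprev x : 'cV[R]_n) i :
  0 <= beta -> vpos x ->
  `|restart_weight A b beta xprev x * (x - xprev) i 0| <= beta * x i 0.
Proof.
move=> b0 /vposP x0; set t := restart_weight _ _ _ _ _.
have t0 : 0 <= t by exact: restart_weight_ge0.
have tle : t <= beta / `|invmx (diag x) *m (x - xprev)| by exact: bigmin_le_id.
have dE : diag x *m (invmx (diag x) *m (x - xprev)) = x - xprev.
  rewrite mulmxA mulmxV ?mul1mx //.
  rewrite unitmxE /diag det_diag unitfE; apply/prodf_neq0 => j _.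
  by rewrite mxE gt_eqF.
set v := invmx _ *m _ in tle dE.
have vle : `|v i 0| <= `|v|.
  by rewrite [X in _ <= X]mx_normrE; exact: (le_bigmax _ (fun ij => `|v ij.1 ij.2|) (i, 0)).
rewrite -dE diagE mulrCA normrM (gtr0_norm (x0 i)) mulrC ler_pM2r // normrM (ger0_norm t0).
apply: le_trans (_ : t * `|v| <= _); first by rewrite ler_wpM2l.
(* A zero norm would make the quotient [beta / 0]; in that case the product to be bounded is zero
   anyway. *)
have [v0|v0] := eqVneq `|v| 0; first by rewrite v0 mulr0.
by rewrite -ler_pdivlMr // lt_def v0 normr_ge0.
Qed.

(** Both residuals are multiples of [r], so one coordinate with [r j 0 != 0] decides: there the
    second term of the minimum is [eta / (eta' - eta)], the weight at which the extrapolated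
    residual reaches zero. The multiple thus shrinks without changing sign. *)
Lemma restart_weight_residual (R : realType) (m n : nat) (A : 'M[R]_(m, n))
    (b r : 'cV[R]_m) (beta eta eta' : R) (xprev x : 'cV[R]_n) :
  0 <= beta -> 0 <= eta -> eta <= eta' ->
  r_b A b x = eta *: r -> r_b A b xprev = eta' *: r ->
  exists etaz, [/\ 0 <= etaz, etaz <= eta &
    r_b A b (x + restart_weight A b beta xprev x *: (x - xprev)) = etaz *: r].
Proof.
move=> b0 eta0 ee' rx ry; set t := restart_weight _ _ _ _ _.
have t0 : 0 <= t by exact: restart_weight_ge0.
have [r0|/eqP] := eqVneq r 0.
  by exists 0; split=> //; rewrite r_b_line rx ry r0 !scaler0 subr0 scaler0 addr0.
move=> rn.
have [j rj] : exists j, r j 0 != 0.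
  apply/existsP; apply: contra_notT rn; rewrite negb_exists => /forallP r0.
  by apply/matrixP => i k; rewrite ord1 mxE; apply/eqP; have := r0 i; rewrite negbK.
exists (eta + t * (eta - eta')); split; last first.
- by rewrite r_b_line rx ry -scalerBl scalerA scalerDl.
- by rewrite gerDl mulr_ge0_le0 // subr_le0.
have [<-|ne] := eqVneq eta eta'; first by rewrite subrr mulr0 addr0.
have lt : 0 < eta' - eta by rewrite subr_gt0 lt_neqAle ne.
have : t <= `|r_b A b x j 0 / (r_b A b x j 0 - r_b A b xprev j 0)|.
  apply: bigmin_le_cond; rewrite rx ry !mxE -subr_eq0 -mulrBl mulf_neq0 //.
  by rewrite subr_eq0.
rewrite rx ry !mxE -mulrBl invfM mulrACA divff // mulr1 normrM (ger0_norm eta0).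
rewrite normfV distrC gtr0_norm // ler_pdivlMr // => h; lra.
Qed.

(** * Effect of the arc and the corrector *)

(** The second derivative and the corrector solve homogeneous equations, so only the first
    derivative, with coefficient [t = sin alpha], changes the residual. *)
Lemma r_c_affine (R : realType) (m n : nat) (A : 'M[R]_(m, n)) (c : 'cV[R]_n)
    (l l1 l2 l3 : 'cV[R]_m) (s s1 s2 s3 : 'cV[R]_n) (t u : R) :
  A^T *m l1 + s1 = r_c A c l s -> A^T *m l2 + s2 = 0 -> A^T *m l3 + s3 = 0 ->
  r_c A c (l - t *: l1 + u *: l2 + l3) (s - t *: s1 + u *: s2 + s3) =
    (1 - t) *: r_c A c l s.
Proof.
move=> h1 /eqP h2 /eqP h3; rewrite {1}/r_c !mulmxDr mulmxN -!scalemxAr.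
have -> : A^T *m l1 = r_c A c l s - s1 by rewrite -h1 addrK.
move: h2 h3; rewrite !addr_eq0 => /eqP -> /eqP ->; rewrite /r_c.
by apply/matrixP => i j; rewrite !mxE; ring.
Qed.

Lemma r_b_affine (R : realType) (m n : nat) (A : 'M[R]_(m, n)) (b : 'cV[R]_m)
    (z x1 x2 x3 : 'cV[R]_n) (t u : R) :
  A *m x1 = r_b A b z -> A *m x2 = 0 -> A *m x3 = 0 ->
  r_b A b (z - t *: x1 + u *: x2 + x3) = (1 - t) *: r_b A b z.
Proof.
move=> h1 h2 h3; rewrite {1}/r_b !mulmxDr mulmxN -!scalemxAr h2 h3 h1 /r_b.
by apply/matrixP => i j; rewrite !mxE; ring.
Qed.

Lemma corrector_prod (R : realType) (m n : nat) (A : 'M[R]_(m, n)) (muk alpha : R)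
    (wa d : iterate R m n) i :
  corrector A muk alpha wa d ->
  (xpart wa + xpart d) i 0 * (spart wa + spart d) i 0 =
    (1 - sin alpha) * muk + xpart d i 0 * spart d i 0.
Proof.
move=> [_ _ /(diag_newtonE i)]; rewrite !mxE mulr1 => e; rewrite mulrDl !mulrDr; lra.
Qed.

(** The second-order terms of [corrector_prod] sum to zero by orthogonality. As the target uses
    [muk], a restart leaves no trace in the new duality measure. *)
Lemma corrector_mu (R : realType) (m n : nat) (A : 'M[R]_(m, n)) (muk alpha : R)
    (wa d : iterate R m n) :
  (0 < n)%N -> corrector A muk alpha wa d ->
  duality_measure (xpart wa + xpart d) (spart wa + spart d) = (1 - sin alpha) * muk.
Proof.
move=> n0 h; have [Ad Ald _] := h.
rewrite /duality_measure dotE (eq_bigr _ (fun i _ => corrector_prod i h)) big_split /=.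
rewrite (kernel_range_orthogonal Ad Ald) addr0 sumr_const card_ord -[X in X / _]mulr_natr mulfK //.
by rewrite pnatr_eq0 -lt0n.
Qed.

(** The deviation from the target [tau] is the product of the two corrections. With [S <= 4 * theta
    ^+ 2 * tau / (1 - 2 * theta)] and the constant 8, its norm bound is at most [theta * tau]
    exactly when [theta * Num.sqrt 2 <= 1 - 2 * theta], that is [theta <= (2 + Num.sqrt 2)^-1]. *)
Lemma corrector_recenters (R : realType) (m n : nat) (A : 'M[R]_(m, n))
    (theta muk alpha : R) (wa d : iterate R m n) :
  (0 < n)%N -> 0 < theta < (2 + Num.sqrt 2)^-1 ->
  vpos (xpart wa) -> vpos (spart wa) ->
  norm2 (cprod (xpart wa) (spart wa) - ((1 - sin alpha) * muk) *: ones)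
    <= 2 * theta * (1 - sin alpha) * muk ->
  corrector A muk alpha wa d ->
  vpos (xpart wa + xpart d) -> vpos (spart wa + spart d) ->
  neighborhood theta (Iterate (xpart wa + xpart d) (lpart wa + lpart d)
                              (spart wa + spart d)).
Proof.
move=> n0 /andP[th0 th1] xp sp near cor xp' sp'.
have := duality_gt0 n0 xp' sp'; have muE := corrector_mu n0 cor; rewrite muE.
set tau := (1 - sin alpha) * muk in near muE * => tau0.
have s2 : Num.sqrt 2 ^+ 2 = 2 :> R by rewrite sqr_sqrtr.
have s20 : 0 <= Num.sqrt 2 :> R by rewrite sqrtr_ge0.
have thS : theta * (2 + Num.sqrt 2) <= 1.
  by rewrite -ler_pdivlMr ?mul1r ?ltW //; lra.
have th2 : theta * Num.sqrt 2 <= 1 - 2 * theta by lra.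
have th12 : 0 < 1 - 2 * theta.
  apply: lt_le_trans th2; rewrite mulr_gt0 // sqrtr_gt0; lra.
have sq : 2 * theta ^+ 2 <= (1 - 2 * theta) ^+ 2.
  rewrite -[X in X * _]s2 -exprMn mulrC ler_sqr ?nnegrE ?mulr_ge0 ?(ltW th0) //; lra.
apply/(neighborhoodP _ n0 th0); split=> //=; rewrite /mu /= muE.
under eq_bigr do rewrite (corrector_prod _ cor) -/tau addrC addKr.
have [Ad Ald eqn] := cor.
move/vposP: xp => xp; move/vposP: sp => sp.
have h8 := sum_sqr_prod_orthogonal xp sp (kernel_range_orthogonal Ad Ald).
have tt : 0 <= 2 * theta * tau by rewrite mulr_ge0 ?(ltW tau0) // mulr_ge0 // ltW.
have nearE : \sum_i (xpart wa i 0 * spart wa i 0 - tau) ^+ 2 <= (2 * theta * tau) ^+ 2.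
  move: near; rewrite -[2 * theta * _ * muk]mulrA -/tau norm2_le // => near.
  by apply: le_trans near; apply: ler_sum => i _; rewrite !mxE mulr1.
have glo i := near_lower_bound i tt nearE.
have hS : \sum_i (spart wa i 0 * xpart d i 0 + xpart wa i 0 * spart d i 0) ^+ 2
    / (xpart wa i 0 * spart wa i 0) <= 4 * theta ^+ 2 * tau / (1 - 2 * theta).
  apply: le_trans (_ : \sum_i (xpart wa i 0 * spart wa i 0 - tau) ^+ 2
      / ((1 - 2 * theta) * tau) <= _).
    apply: ler_sum => i _.
    have -> : spart wa i 0 * xpart d i 0 + xpart wa i 0 * spart d i 0 =
        tau - xpart wa i 0 * spart wa i 0.
      have := corrector_prod i cor; rewrite !mxE -/tau; lra.
    rewrite -sqrrN opprB ler_wpM2l ?sqr_ge0 // lef_pV2 ?posrE //.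
      by rewrite mulr_gt0.
    exact: mulr_gt0 th12 tau0.
  rewrite -mulr_suml ler_pdivrMr ?(mulr_gt0 th12 tau0) //; apply: le_trans nearE _.
  rewrite le_eqVlt; apply/orP; left; apply/eqP; field; lra.
set S := \sum_i _ / _ in h8 hS.
have S0 : 0 <= S.
  by apply: sumr_ge0 => i _; rewrite divr_ge0 ?sqr_ge0 // mulr_ge0 // ltW.
have S8 : S ^+ 2 <= 8 * (theta * tau) ^+ 2.
  apply: le_trans (_ : (4 * theta ^+ 2 * tau / (1 - 2 * theta)) ^+ 2 <= _).
    by rewrite ler_sqr ?nnegrE // (le_trans S0 hS).
  rewrite expr_div_n ler_pdivrMr ?exprn_gt0 //.
  rewrite -subr_ge0 [X in 0 <= X](_ : _ = 8 * (theta * tau) ^+ 2 *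
    ((1 - 2 * theta) ^+ 2 - 2 * theta ^+ 2)); last by ring.
  by rewrite mulr_ge0 ?subr_ge0 // mulr_ge0 // sqr_ge0.
lra.
Qed.

(** * Invariants along the iteration *)

Lemma restart_point_spec (R : realType) (m n : nat) (A : 'M[R]_(m, n)) (b r : 'cV[R]_m)
    (theta beta eta : R) (w : nat -> iterate R m n) (k : nat)
    (z := restart_point A b theta beta w k) :
  0 < beta < 1 -> vpos (xpart (w k)) -> vpos (spart (w k)) -> 0 <= eta ->
  r_b A b (xpart (w k)) = eta *: r ->
  (forall j, k = j.+1 -> exists2 eta', eta <= eta' & r_b A b (xpart (w j)) = eta' *: r) ->
  [/\ exists etaz, [/\ 0 <= etaz, etaz <= eta & r_b A b z = etaz *: r],
      (1 - beta) * mu (w k) <= duality_measure z (spart (w k)) &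
      z = xpart (w k) \/ neighborhood theta (Iterate z (lpart (w k)) (spart (w k)))].
Proof.
move=> /andP[b0 b1] xp sp eta0 rx rprev; rewrite {}/z.
have mu0 : 0 <= mu (w k).
  rewrite /mu /duality_measure dotE divr_ge0 // sumr_ge0 // => i _.
  by rewrite mulr_ge0 // ltW //; apply/vposP: i.
have self : [/\ exists etaz, [/\ 0 <= etaz, etaz <= eta & r_b A b (xpart (w k)) = etaz *: r],
      (1 - beta) * mu (w k) <= duality_measure (xpart (w k)) (spart (w k)) &
      xpart (w k) = xpart (w k) \/
      neighborhood theta (Iterate (xpart (w k)) (lpart (w k)) (spart (w k)))].
  split; [by exists eta| |by left].
  by rewrite -/(mu (w k)) ler_piMl //; lra.
case: k => [//|k] in xp sp rx rprev mu0 self *.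
rewrite /restart_point; case: ifP => // nb; split; [| |by right].
- have [eta' ee' ry] := rprev k erefl.
  exact: (restart_weight_residual (ltW b0) eta0 ee' rx ry).
- rewrite /mu /duality_measure mulrA ler_wpM2r ?invr_ge0 ?ler0n //.
  rewrite !dotE mulr_sumr; apply: ler_sum => i _; rewrite mulrA ler_wpM2r //.
    by rewrite ltW //; apply/vposP: i.
  have := restart_weight_relative A b (xpart (w k)) i (ltW b0) xp.
  by rewrite ler_norml => /andP[h _]; rewrite !mxE in h *; lra.
Qed.

(* [l] is the number of steps made so far from points of the neighborhood, and
   [sg] a lower bound for [sin alpha] in each of them. *)
Definition progress (R : realType) (m n : nat) (A : 'M[R]_(m, n)) (b : 'cV[R]_m)
    (c : 'cV[R]_n) (theta sg : R) (w : nat -> iterate R m n) (k : nat)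
    (eta nu : R) (l : nat) : Prop :=
  [/\ [/\ 0 <= eta, eta <= nu & nu <= 1],
      [/\ r_b A b (xpart (w k)) = eta *: r_b A b (xpart (w 0%N)),
          r_c A c (lpart (w k)) (spart (w k)) =
            nu *: r_c A c (lpart (w 0%N)) (spart (w 0%N))
        & mu (w k) = nu * mu (w 0%N)],
      forall j, k = j.+1 -> exists2 eta', eta <= eta' &
        r_b A b (xpart (w j)) = eta' *: r_b A b (xpart (w 0%N)),
      nu <= expR (- (sg * l%:R))
    & neighborhood theta (w k) /\ (k <= 2 * l)%N \/ (k < 2 * l)%N].

(** The last clause of [progress] does the bookkeeping: outside the neighborhood the index must be
    strictly below [2 * l], and this spare unit pays for one step that does not increase [l]. *)
Lemma progress_step (R : realType) (m n : nat) (A : 'M[R]_(m, n)) (b : 'cV[R]_m)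
    (c : 'cV[R]_n) (theta beta rho eta nu : R) (w : nat -> iterate R m n)
    (ws : iterate R m n) (k l : nat)
    (sg := theta / 8 / (36 * rho ^+ 2 * (1 - beta)^-1 * n%:R)) :
  (0 < n)%N -> 0 < theta < (2 + Num.sqrt 2)^-1 -> 0 < beta < 1 -> 1 <= rho ->
  vpos (xpart (w 0%N)) -> vpos (spart (w 0%N)) ->
  primal_dual_optimal A b c ws ->
  vle (xpart ws) (rho *: xpart (w 0%N)) -> vle (spart ws) (rho *: spart (w 0%N)) ->
  progress A b c theta sg w k eta nu l ->
  iteration A b c theta beta w k ->
  vpos (xpart (w k.+1)) -> vpos (spart (w k.+1)) ->
  exists eta' nu' l', progress A b c theta sg w k.+1 eta' nu' l'.
Proof.
move=> n0 th hb rho1 x00 s00 opt xsr ssr [[eta0 etanu nu1] [rb rc muk] prev nuE near] it xp' sp'.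
have thh : 0 < theta < 2^-1.
  have s20 : 0 <= Num.sqrt 2 :> R by rewrite sqrtr_ge0.
  by case/andP: th => -> /lt_le_trans; apply; rewrite lef_pV2 ?posrE //; lra.
have [b0 b1] := andP hb; have [th0 _] := andP thh.
case: it => xp [sp [d1 [d2 [d [alpha [fd sd ls cor wE]]]]]].
have [[etaz [ez0 eze rz]] muz zcase] := restart_point_spec theta hb xp sp eta0 rb prev.
set z := restart_point _ _ _ _ _ _ in fd sd ls cor wE rz muz zcase *.
have [[/andP[al0 alpi] adm] _] := ls.
have [admx adms admn] : arc_admissible theta (duality_measure z (spart (w k)))
    (Defs.arc z (w k) d1 d2) alpha by apply: adm; rewrite al0 lexx.
have s0 : 0 <= sin alpha.
  by rewrite sin_ge0_pi // ltW //= (le_trans alpi) // ler_pdivrMr // ler_peMr ?pi_ge0 // ler1n.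
have s1 := sin_le1 alpha.
have [Ad1 Al1 _] := fd; have [Ad2 Al2 _] := sd; have [Ad Al _] := cor.
have rb' : r_b A b (xpart (w k.+1)) = ((1 - sin alpha) * etaz) *: r_b A b (xpart (w 0%N)).
  by rewrite wE /= (r_b_affine _ _ Ad1 Ad2 Ad) rz scalerA.
have rc' : r_c A c (lpart (w k.+1)) (spart (w k.+1)) =
    ((1 - sin alpha) * nu) *: r_c A c (lpart (w 0%N)) (spart (w 0%N)).
  by rewrite wE /= (r_c_affine _ _ Al1 Al2 Al) rc scalerA.
have muk' : mu (w k.+1) = (1 - sin alpha) * nu * mu (w 0%N).
  by rewrite wE /mu (corrector_mu n0 cor) muk mulrA.
have nu0 : 0 <= nu by lra.
have ord : [/\ 0 <= (1 - sin alpha) * etaz, (1 - sin alpha) * etaz <= (1 - sin alpha) * nu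
    & (1 - sin alpha) * nu <= 1].
  split; [by rewrite mulr_ge0 // subr_ge0|by rewrite ler_wpM2l ?subr_ge0 //; lra|].
  by rewrite mulr_ile1 // ?subr_ge0 //; lra.
have prev' j : k.+1 = j.+1 -> exists2 eta', (1 - sin alpha) * etaz <= eta' &
    r_b A b (xpart (w j)) = eta' *: r_b A b (xpart (w 0%N)).
  move=> [<-]; exists eta => //; apply: le_trans eze.
  by rewrite ler_piMl //; lra.
exists ((1 - sin alpha) * etaz), ((1 - sin alpha) * nu).
have [nbz|nbz] := boolP (neighborhood theta (Iterate z (lpart (w k)) (spart (w k)))).
- exists l.+1; split=> //; last first.
    (* The new iterate may have left the neighborhood, so the strict alternative is proved:
       [k <= 2 * l] gives [k.+1 < 2 * l.+1]. *)
    by right; rewrite mulnS add2n !ltnS; case: near => [[]|/ltnW].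
  have K1 : 1 <= (1 - beta)^-1 by rewrite invf_ge1; lra.
  have nuK : nu * mu (w 0%N) <= (1 - beta)^-1 * duality_measure z (spart (w k)).
    by rewrite -muk mulrC ler_pdivlMr 1?mulrC //; lra.
  have [aN bN] := first_derivative_bound n0 thh rho1 x00 s00 opt xsr ssr nbz ez0
    (le_trans eze etanu) nu1 rz rc K1 nuK fd.
  have N1 : 1 <= 36 * rho ^+ 2 * (1 - beta)^-1 * n%:R.
    rewrite mulr_ege1 ?ler1n // mulr_ege1 //.
    have : 1 <= rho ^+ 2 by rewrite exprn_ege1.
    lra.
  have sgl : sg <= sin alpha := largest_step_lower_bound n0 thh N1 nbz fd sd aN bN ls.
  have -> : - (sg * l.+1%:R) = - sg + - (sg * l%:R) by rewrite -natr1; ring.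
  rewrite expRD; apply: ler_pM; rewrite ?subr_ge0 //.
  (* [1 - sin alpha <= 1 - sg <= expR (- sg)]. *)
  by apply: le_trans (expR_ge1Dx _); rewrite lerD2l lerN2.
- exists l; split=> //; first by apply: le_trans nuE; rewrite ler_piMl //; lra.
  (* An extrapolated point would lie in the neighborhood, so [z] is the iterate itself; arc and
     corrector then aim at the same value. *)
  case: zcase => [zE|]; last by rewrite (negbTE nbz).
  have k2l : (k < 2 * l)%N.
    case: near => [[nb _]|//]; move: nbz; rewrite zE.
    by case: (w k) nb => x l1 s /= ->.
  left; split=> //.
  move: xp' sp'; rewrite wE => xp' sp'.
  apply: (corrector_recenters n0 th admx adms _ cor xp' sp').
  by move: admn; rewrite zE -/(mu (w k)).
Qed.

(** * Termination and iteration count *)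

Lemma norm2_ge0 (R : realType) (p : nat) (v : 'cV[R]_p) : 0 <= norm2 v.
Proof. exact: sqrtr_ge0. Qed.

Lemma stopping_of_ratio (R : realType) (m n : nat) (A : 'M[R]_(m, n)) (b : 'cV[R]_m)
    (c : 'cV[R]_n) (eps eta nu : R) (w0 w : iterate R m n) :
  0 < mu w0 -> 0 <= eta -> eta <= nu -> nu * mu w0 <= eps ->
  r_b A b (xpart w) = eta *: r_b A b (xpart w0) ->
  r_c A c (lpart w) (spart w) = nu *: r_c A c (lpart w0) (spart w0) ->
  mu w = nu * mu w0 ->
  stopping_criterion A b c eps w0 w.
Proof.
move=> m0 eta0 etanu nue rb rc muw; have nu0 := le_trans eta0 etanu.
have scale e (u : R) : e <= nu -> 0 <= u -> e * u <= u / mu w0 * eps.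
  move=> en u0; rewrite mulrC -mulrA ler_wpM2l // mulrC ler_pdivlMr //.
  by apply: le_trans nue; rewrite ler_pM2r.
by split; rewrite ?muw // ?rb ?rc norm2Z // scale ?norm2_ge0.
Qed.

(** In dimension zero, division by zero makes [mu] equal to 0 and feasibility forces [b = 0], so the
    initial point already stops. *)
Lemma stopping_dim0 (R : realType) (m : nat) (A : 'M[R]_(m, 0)) (b : 'cV[R]_m)
    (c : 'cV[R]_0) (eps : R) (w : iterate R m 0) :
  0 < eps -> interior_feasible A b c -> stopping_criterion A b c eps w w.
Proof.
move=> e0 [[x [_ Ax]] _].
have norm0 (p : nat) (v : 'cV[R]_p) : v = 0 -> norm2 v <= norm2 v / mu w * eps.
  move=> ->; have -> : norm2 (0 : 'cV[R]_p) = 0.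
    by rewrite /norm2 big1 ?sqrtr0 // => i _; rewrite mxE expr0n.
  by rewrite !mul0r.
split; [|apply: norm0|apply: norm0].
- by rewrite /mu /duality_measure invr0 mulr0 ltW.
- by rewrite /r_b -Ax !(flatmx0 (_ : 'cV_0)) subrr.
- exact: flatmx0.
Qed.

(** At least half of the first [K] steps contract [nu] by [expR (- sg)] or better, whence the
    condition on [K%:R / 2]. *)
Lemma stops_within (R : realType) (m n : nat) (A : 'M[R]_(m, n)) (b : 'cV[R]_m)
    (c : 'cV[R]_n) (theta beta rho eps : R) (w : nat -> iterate R m n)
    (ws : iterate R m n) (K : nat)
    (sg := theta / 8 / (36 * rho ^+ 2 * (1 - beta)^-1 * n%:R)) :
  (0 < n)%N -> 0 < theta < (2 + Num.sqrt 2)^-1 -> 0 < beta < 1 -> 1 <= rho -> 0 < eps ->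
  neighborhood theta (w 0%N) -> primal_dual_optimal A b c ws ->
  vle (xpart ws) (rho *: xpart (w 0%N)) -> vle (spart ws) (rho *: spart (w 0%N)) ->
  generated A b c theta beta eps w ->
  ln (mu (w 0%N) / eps) <= sg * (K%:R / 2) ->
  exists2 k, (k <= K)%N & stopping_criterion A b c eps (w 0%N) (w k).
Proof.
move=> n0 th hb rho1 e0 nb opt xsr ssr gen Kle.
have [th0 _] := andP th.
have [x00 s00 _] := and3P nb.
have m0 : 0 < mu (w 0%N) by exact: duality_gt0.
case: (pselect (exists2 k, (k <= K)%N & stopping_criterion A b c eps (w 0%N) (w k))) => // nostop.
have it k : (k <= K)%N -> iteration A b c theta beta w k.
  by move=> kK; apply: gen => j jk st; apply: nostop; exists j => //; exact: leq_trans kK.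
(* Positivity of the next iterate is read off from the iteration performed there, available because
   no index up to [K] stops. *)
have prog k : (k <= K)%N -> exists eta nu l, progress A b c theta sg w k eta nu l.
  elim: k => [_|k IH kK].
    exists 1, 1, 0%N; split=> //; try by rewrite !scale1r mul1r.
      by rewrite mulr0 oppr0 expR0.
    by left.
  have [eta [nu [l pr]]] := IH (ltnW kK).
  have [xp [sp _]] := it _ kK.
  exact: (progress_step n0 th hb rho1 x00 s00 opt xsr ssr pr (it _ (ltnW kK)) xp sp).
have [eta [nu [l [[eta0 etanu _] [rb rc muk] _ nuE near]]]] := prog K (leqnn K).
have K2l : (K <= 2 * l)%N by case: near => [[]|/ltnW].
exists K => //; apply: stopping_of_ratio rb rc muk => //.
have sg0 : 0 <= sg.
  have [b0 b1] := andP hb.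
  have d0 : 0 <= 36 * rho ^+ 2 * (1 - beta)^-1 * n%:R.
    by rewrite mulr_ge0 // divr_ge0 ?subr_ge0 ?(ltW b1) // mulr_ge0 // sqr_ge0.
  by rewrite divr_ge0 // divr_ge0 // ltW.
have Ll : ln (mu (w 0%N) / eps) <= sg * l%:R.
  apply: le_trans Kle _; rewrite ler_wpM2l // ler_pdivrMr // mulrC.
  by rewrite -natrM ler_nat.
rewrite -ler_pdivlMr //; apply: le_trans nuE _.
have lE : expR (ln (mu (w 0%N) / eps)) = mu (w 0%N) / eps by rewrite lnK // posrE divr_gt0.
by rewrite -[leRHS]invf_div -lE -expRN ler_expR lerN2.
Qed.

Theorem theorem4p2 (R : realType) (theta beta rho : R)
    (htheta : 0 < theta < (2 + Num.sqrt 2)^-1)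
    (hbeta : 0 < beta < 1) (hrho : 1 <= rho) :
  exists C : R, 0 < C /\
    forall (m n : nat) (A : 'M[R]_(m, n)) (b : 'cV[R]_m) (c : 'cV[R]_n)
      (eps : R) (w : nat -> iterate R m n),
      interior_feasible A b c ->
      row_free A ->
      0 < eps < 1 ->
      neighborhood theta (w 0%N) ->
      (exists wstar : iterate R m n,
          [/\ primal_dual_optimal A b c wstar,
              vle (xpart wstar) (rho *: xpart (w 0%N))
            & vle (spart wstar) (rho *: spart (w 0%N))]) ->
      generated A b c theta beta eps w ->
      let L := ln (mu (w 0%N) / eps) in
      exists k : nat,
        [/\ terminates_at A b c eps w k,
            mu (w k) <= eps,
            norm2 (r_b A b (xpart (w k)))
              <= norm2 (r_b A b (xpart (w 0%N))) / mu (w 0%N) * eps,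
            norm2 (r_c A c (lpart (w k)) (spart (w k)))
              <= norm2 (r_c A c (lpart (w 0%N)) (spart (w 0%N))) / mu (w 0%N) * eps
          & (k%:Z <= Num.ceil (Num.max 0 (C * n%:R * L)))%R].
Proof.
have [th0 _] := andP htheta; have [b0 b1] := andP hbeta.
pose M := 36 * rho ^+ 2 * (1 - beta)^-1.
have M0 : 0 < M.
  rewrite /M mulr_gt0 ?invr_gt0 ?subr_gt0 // mulr_gt0 // exprn_gt0 //.
  exact: lt_le_trans hrho.
(* A step from the neighborhood has [sin alpha >= theta / (8 * M * n)]; counting only half of the
   steps turns 8 into 16. *)
exists (16 * M / theta); split; first by rewrite divr_gt0 // mulr_gt0.
move=> m n A b c eps w feas _ /andP[e0 _] nb [ws [opt xsr ssr]] gen L.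
(* The maximum with 0 covers an initial [mu] below [eps], for which [L] is negative. *)
set B := Num.max 0 _.
have cB : 0 <= Num.ceil B by rewrite ceil_ge0 (lt_le_trans _ (_ : 0 <= B)) ?ltrN10 // le_max lexx.
have [k kB stop] : exists2 k : nat, k%:Z <= Num.ceil B &
    stopping_criterion A b c eps (w 0%N) (w k).
  have [n0|n0] := posnP n.
    by exists 0%N => //; subst n; exact: stopping_dim0.
  have KE : `|Num.ceil B|%N%:Z = Num.ceil B by rewrite gez0_abs.
  have KB : B <= `|Num.ceil B|%N%:R by rewrite -[_%:R]/((`|Num.ceil B|%N%:Z)%:~R) KE ceil_ge.
  have [|k kK st] := @stops_within _ _ _ A b c theta beta rho eps w ws `|Num.ceil B|%N
    n0 htheta hbeta hrho e0 nb opt xsr ssr gen; last first.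
    by exists k => //; rewrite -KE lez_nat.
  have nR : 0 < n%:R :> R by rewrite ltr0n.
  have : 16 * M / theta * n%:R * L <= `|Num.ceil B|%N%:R.
    by apply: le_trans KB; rewrite /B le_max lexx orbT.
  rewrite -/L -/M; set K := `|_|%N%:R => LK.
  have -> : theta / 8 / (M * n%:R) * (K / 2) = K / (16 * M / theta * n%:R).
    by field; rewrite !gt_eqF.
  have d0 : 0 < 16 * M / theta * n%:R by rewrite mulr_gt0 // divr_gt0 // mulr_gt0.
  by rewrite ler_pdivlMr // mulrC.
(* [terminates_at] asks for the first stopping index, so the least one is taken; it inherits the
   bound on [k]. *)
have ex : exists k, `[< stopping_criterion A b c eps (w 0%N) (w k) >].
  by exists k; apply/asboolP.
have [j /asboolP stj jmin] := ex_minnP ex.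
have [st1 st2 st3] := stj.
exists j; split=> //; first split=> // i ij sti.
  by have := jmin i; rewrite leqNgt ij => /(_ (introT (asboolP _) sti)).
by apply: le_trans kB; rewrite lez_nat jmin //; apply/asboolP.
Qed.
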